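(* Let $\mathcal{A}:\mathbb{S}^d\to\mathbb{R}^n$ be a linear map and fix a positive integer $k<d$. Then the following two statements hold. (1) Suppose that $\mathcal{A}$ is surjective and $\mathrm{null}(\mathcal{A})\cap\mathbb{S}^d_{++}\neq\emptyset$. Let $\mathcal{B}:\mathbb{S}^d\to\mathbb{R}^{n+1}$ be the linear map $\mathcal{B}(X)=\begin{pmatrix}\mathcal{A}(X)\\ \mathrm{tr}(X)\end{pmatrix}$. If $\mathcal{A}$ satisfies the exact recovery property (with respect to $k$), then the cone $\mathcal{B}(\mathbb{S}^d_+)$ satisfies the Terracini convexity property (with respect to $k$). (2) Assume that $n>\binom{d+1}{2}-\binom{d-k+1}{2}$. Suppose there exists an open set $\mathfrak{S}$ in the space of linear maps from $\mathbb{S}^d$ to $\mathbb{R}^n$ such that: (i) $\mathcal{A}\in\mathfrak{S}$; (ii) each $\tilde{\mathcal{A}}\in\mathfrak{S}$ is surjective and satisfies $\mathrm{null}(\tilde{\mathcal{A}})\cap\mathbb{S}^d_{++}\neq\emptyset$; (iii) for each $\tilde{\mathcal{A}}\in\mathfrak{S}$, with associated map $\tilde{\mathcal{B}}:\mathbb{S}^d\to\mathbb{R}^{n+1}$, $\tilde{\mathcal{B}}(X)=\begin{pmatrix}\tilde{\mathcal{A}}(X)\\ \mathrm{tr}(X)\end{pmatrix}$, the cone $\tilde{\mathcal{B}}(\mathbb{S}^d_+)$ satisfies the Terracini convexity property (with respect to $k$). Then $\mathcal{A}$ satisfies the exact recovery property (with respect to $k$).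
   Context: $\mathbb{S}^d$ is the space of $d\times d$ real symmetric matrices, $\mathbb{S}^d_+$ (resp. $\mathbb{S}^d_{++}$) the positive semidefinite (resp. positive definite) ones. For a linear map $\mathcal{A}:\mathbb{S}^d\to\mathbb{R}^n$ and $b\in\mathbb{R}^n$, $SDP(\mathcal{A},b)$ denotes the set of optimal solutions of: minimize $\mathrm{tr}(X)$ over $X\in\mathbb{S}^d$ subject to $\mathcal{A}(X)=b$, $X\succeq0$. Exact recovery property (with respect to $k$): for every $X^\star\in\mathbb{S}^d_+$ with $\mathrm{rank}(X^\star)\leq k$, $SDP(\mathcal{A},\mathcal{A}(X^\star))=\{X^\star\}$. Terracini convexity property (with respect to $k$), for a linear map $\mathcal{B}:\mathbb{S}^d\to\mathbb{R}^N$: the cone $\mathcal{B}(\mathbb{S}^d_+)$ is closed and pointed, its extreme rays are in one-to-one correspondence with those of $\mathbb{S}^d_+$ (via the map $\mathcal{B}$, i.e. $\mathcal{B}$ induces a bijection from the extreme rays of $\mathbb{S}^d_+$ to those of $\mathcal{B}(\mathbb{S}^d_+)$), and it is $k$-Terracini convex. $k$-Terracini convexity: for a closed, pointed ($\mathcal{C}\cap(-\mathcal{C})=\{0\}$), convex cone $\mathcal{C}$ and $x\in\mathcal{C}$, let $\mathcal{T}_{\mathcal{C}}(x)=\overline{\mathrm{cone}\{z-x:z\in\mathcal{C}\}}$ be the tangent cone and $\mathcal{L}_{\mathcal{C}}(x)=\mathcal{T}_{\mathcal{C}}(x)\cap(-\mathcal{T}_{\mathcal{C}}(x))$ the convex tangent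 space. $\mathcal{C}$ is $k$-Terracini convex if $\mathcal{L}_{\mathcal{C}}\big(\sum_{i=1}^kx^{(i)}\big)=\sum_{i=1}^k\mathcal{L}_{\mathcal{C}}(x^{(i)})$ for any collection $x^{(1)},\ldots,x^{(k)}$ of (not necessarily distinct) generators of extreme rays of $\mathcal{C}$. *)

(* Defs.v *)
From HB Require Import structures.
From mathcomp Require Import all_boot all_order all_algebra.
From mathcomp Require Import all_classical all_reals all_analysis.

Set Implicit Arguments.
Unset Strict Implicit.
Unset Printing Implicit Defensive.

Import Order.TTheory GRing.Theory Num.Theory.
Import numFieldNormedType.Exports.

Local Open Scope classical_set_scope.
Local Open Scope ring_scope.

Section SymmetricMatrices.
Variables (R : realType) (d : nat).

Fact symmetricmx_submod_closed :
  submod_closed (symmetricmx : {pred 'M[R]_d}).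
Proof.
have symE (X : 'M[R]_d) : (X \is symmetricmx) = (X == X^T).
  by rewrite is_hermitianmxE expr0 scale1r map_mx_id.
split=> [|a X Y]; first by rewrite symE trmx0.
rewrite !symE => /eqP eX /eqP eY.
by apply/eqP; rewrite linearD linearZ /= -eX -eY.
Qed.

HB.instance Definition _ := GRing.isSubmodClosed.Build R 'M[R]_d
  (symmetricmx : {pred 'M[R]_d}) symmetricmx_submod_closed.

Record symmx := SymMx {
  symmx_val :> 'M[R]_d;
  symmx_valP : symmx_val \is symmetricmx }.

HB.instance Definition _ := [isSub for symmx_val].
HB.instance Definition _ := [Choice of symmx by <:].
HB.instance Definition _ := [SubChoice_isSubLmodule of symmx by <:].

Definition psd : set symmx :=
  [set X | forall v : 'cV[R]_d, 0 <= (v^T *m X *m v) 0 0].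

Definition posdef : set symmx :=
  [set X | forall v : 'cV[R]_d, v != 0 -> 0 < (v^T *m X *m v) 0 0].

End SymmetricMatrices.

Section Cones.
Variable R : realType.

Section Algebraic.
Variable V : lmodType R.
Implicit Types (C S r : set V) (x : V).

Definition conic_hull S : set V :=
  [set v | exists m (c : 'I_m -> R) (y : 'I_m -> V),
     (forall i, 0 <= c i /\ S (y i)) /\ v = \sum_i c i *: y i].

Definition pointed_cone C := C `&` [set - x | x in C] = [set 0].

Definition ray x : set V := [set t *: x | t in [set t : R | 0 <= t]].

(* an extreme ray is a one-dimensional face which is a half-line from 0 *)
Definition extreme_ray C r :=
  [/\ exists2 x, x != 0 & r = ray x,
      r `<=` C
    & forall y z, C y -> C z -> r (y + z) -> r y /\ r z].

Definition generates_extreme_ray C x := x != 0 /\ extreme_ray C (ray x).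

End Algebraic.

Section Topological.
Variable V : normedModType R.
Implicit Types (C : set V) (x : V).

Definition tangent_cone C x : set V :=
  closure (conic_hull [set z - x | z in C]).

Definition tangent_space C x : set V :=
  tangent_cone C x `&` [set - v | v in tangent_cone C x].

Definition terracini_convex (k : nat) C :=
  forall x : 'I_k -> V, (forall i, generates_extreme_ray C (x i)) ->
    tangent_space C (\sum_i x i) =
    [set v | exists u : 'I_k -> V,
       (forall i, tangent_space C (x i) (u i)) /\ v = \sum_i u i].

End Topological.
End Cones.

Section Properties.
Variables (R : realType) (d : nat).

Definition SDP n (A : {linear symmx R d -> 'cV[R]_n}) (b : 'cV[R]_n) :
    set (symmx R d) :=
  let feasible := [set X | A X = b /\ psd X] in
  [set X | feasible X /\ forall Y, feasible Y -> \tr X <= \tr Y].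

Definition exact_recovery n (A : {linear symmx R d -> 'cV[R]_n}) (k : nat) :=
  forall X : symmx R d, psd X -> (\rank X <= k)%N -> SDP A (A X) = [set X].

Definition terracini_convexity_property N
    (B : {linear symmx R d -> 'cV[R]_N}) (k : nat) :=
  let C := B @` @psd R d in
  [/\ closed C,
      pointed_cone C,
      set_bij (extreme_ray (@psd R d)) (extreme_ray C) (fun r => B @` r)
    & terracini_convex k C].

Definition trace_augment n (A : {linear symmx R d -> 'cV[R]_n})
    (X : symmx R d) : 'cV[R]_(n + 1) :=
  col_mx (A X) (\tr X)%:M.

Fact trace_augment_is_linear n (A : {linear symmx R d -> 'cV[R]_n}) :
  linear (trace_augment A).
Proof.
move=> a X Y; rewrite /trace_augment linearP /=.
by rewrite linearD linearZ /= scale_col_mx add_col_mx scale_scalar_mx raddfD.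
Qed.

HB.instance Definition _ n (A : {linear symmx R d -> 'cV[R]_n}) :=
  GRing.isLinear.Build R (symmx R d) 'cV[R]_(n + 1) _ (trace_augment A)
    (trace_augment_is_linear A).

(* Openness for the topology of the operator norm, which is the unique
   Hausdorff vector space topology on this finite-dimensional space. Matrices
   and vectors carry the sup norm of their entries. *)
Definition open_linear_maps n (S : set {linear symmx R d -> 'cV[R]_n}) :=
  forall A, S A -> exists2 e : R, 0 < e &
    forall A' : {linear symmx R d -> 'cV[R]_n},
      (forall X, `|A' X - A X| <= e * `|X : 'M[R]_d|) -> S A'.

Definition surjective_with_posdef_kernel n
    (A : {linear symmx R d -> 'cV[R]_n}) :=
  set_surj [set: symmx R d] [set: 'cV[R]_n] A /\
  ([set X | A X = 0] `&` @posdef R d) !=set0.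

End Properties.

(* Main.v *)
Require Import Defs.
From HB Require Import structures.
From mathcomp Require Import all_boot all_order all_algebra.
From mathcomp Require Import all_classical all_reals all_analysis.
From mathcomp Require Import ring lra.
Import Order.TTheory GRing.Theory Num.Theory.
Import numFieldNormedType.Exports.
Local Open Scope classical_set_scope.
Local Open Scope ring_scope.

Set Implicit Arguments.
Unset Strict Implicit.
Unset Printing Implicit Defensive.

(* Let K(v) be the symmetric matrices that are positive semidefinite on the
   orthogonal complement of v_1, ..., v_m. By inertia, every W in K(v) becomes
   positive semidefinite after adding some sum of m squares a_i a_i^T, so exact
   recovery forces the kernel of B = (A, tr) to meet K(v) only at 0 for every
   family of at most k vectors. Under that condition B(K(v)) is closed,
   whence the tangent space of the cone at B(sum v_i v_i^T) is the image of the
   matrices sum (v_i a_i^T + a_i v_i^T), and these spaces are visibly additive.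

   Conversely, a failure of recovery gives W in the kernel of A with trace at
   most 0 and W + X psd, X = sum v_i v_i^T. A small perturbation of A makes the
   trace negative; adding a positive definite kernel element then shows that
   B(X) is interior to the cone, so its tangent space is the whole range of B.
   The bijection of extreme rays is the case m = 1 of the kernel condition, so
   Terracini convexity identifies this tangent space with the image of the
   matrices sum (v_i a_i^T + a_i v_i^T), of dimension less than n. *)

(** * Bilinear forms, squares and Cauchy-Schwarz for symmetric matrices *)

Section Forms.
Variables (R : realType) (d : nat).
Implicit Types (u v w a b : 'cV[R]_d) (X Y W P : symmx R d) (M : 'M[R]_d).

Definition dot u w : R := (u^T *m w) 0 0.
Definition bform M u w : R := (u^T *m M *m w) 0 0.

Lemma dotC u w : dot u w = dot w u.
Proof. by rewrite /dot -[u^T *m w]trmxK trmx_mul trmxK mxE. Qed.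

Lemma dotE u w : dot u w = \sum_i u i 0 * w i 0.
Proof. by rewrite /dot !mxE; apply: eq_bigr => i _; rewrite mxE. Qed.

Lemma dotDr u w1 w2 : dot u (w1 + w2) = dot u w1 + dot u w2.
Proof. by rewrite /dot mulmxDr mxE. Qed.

Lemma dotZr u t w : dot u (t *: w) = t * dot u w.
Proof. by rewrite /dot -scalemxAr mxE. Qed.

Lemma dot0r u : dot u 0 = 0.
Proof. by rewrite /dot mulmx0 mxE. Qed.

Lemma dot_ge0 u : 0 <= dot u u.
Proof. by rewrite dotE sumr_ge0 // => i _; rewrite -expr2 sqr_ge0. Qed.

Lemma dot_gt0 u : u != 0 -> 0 < dot u u.
Proof.
move=> u0; rewrite lt_neqAle dot_ge0 andbT eq_sym; apply: contra u0 => /eqP.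
rewrite dotE => /eqP; rewrite psumr_eq0 => [/allP u0|i _]; last first.
  by rewrite -expr2 sqr_ge0.
apply/eqP/matrixP => i j; rewrite ord1 mxE.
by have := u0 i (mem_index_enum _); rewrite mulf_eq0 orbb => /eqP.
Qed.

Lemma dot_eq0 u : (forall w, dot u w = 0) -> u = 0.
Proof.
by move=> u0; apply/eqP; apply: contraT => /dot_gt0; rewrite u0 ltxx.
Qed.

Lemma bform_dot M u w : bform M u w = dot u (M *m w).
Proof. by rewrite /bform /dot mulmxA. Qed.

Lemma bformDl M u1 u2 w : bform M (u1 + u2) w = bform M u1 w + bform M u2 w.
Proof. by rewrite /bform linearD !mulmxDl mxE. Qed.

Lemma bformDr M u w1 w2 : bform M u (w1 + w2) = bform M u w1 + bform M u w2.
Proof. by rewrite /bform !mulmxDr mxE. Qed.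

Lemma bformZl M t u w : bform M (t *: u) w = t * bform M u w.
Proof. by rewrite /bform linearZ -!scalemxAl mxE. Qed.

Lemma bformZr M t u w : bform M u (t *: w) = t * bform M u w.
Proof. by rewrite /bform -!scalemxAr mxE. Qed.

Lemma bform0 u w : bform 0 u w = 0.
Proof. by rewrite /bform mulmx0 mul0mx mxE. Qed.

Lemma bformDm M N u w : bform (M + N) u w = bform M u w + bform N u w.
Proof. by rewrite /bform mulmxDr mulmxDl mxE. Qed.

Lemma bformZm t M u w : bform (t *: M) u w = t * bform M u w.
Proof. by rewrite /bform -scalemxAr -scalemxAl mxE. Qed.

Lemma bform_summ (I : finType) (F : I -> 'M[R]_d) u w :
  bform (\sum_i F i) u w = \sum_i bform (F i) u w.
Proof.
apply: (big_ind2 (fun M t => bform M u w = t)) => [|M1 t1 M2 t2 <- <-|//].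
  exact: bform0.
exact: bformDm.
Qed.

Lemma bform_outer a b u w : bform (a *m b^T) u w = dot a u * dot b w.
Proof.
rewrite /bform /dot mulmxA -mulmxA mxE big_ord1; congr (_ * _).
by rewrite -/(dot u a) dotC.
Qed.

Lemma symmxT X : (X : 'M[R]_d)^T = X.
Proof.
have := symmx_valP X.
by rewrite is_hermitianmxE expr0 scale1r map_mx_id // => /eqP.
Qed.

Lemma sym_subproof M : M + M^T \is symmetricmx.
Proof.
by rewrite is_hermitianmxE expr0 scale1r map_mx_id // linearD /= trmxK addrC.
Qed.

Definition sym M : symmx R d := SymMx (sym_subproof M).

Lemma symmxD X Y : symmx_val (X + Y) = symmx_val X + symmx_val Y.
Proof. exact: (raddfD \val). Qed.

Lemma symmxZ t X : symmx_val (t *: X) = t *: symmx_val X.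
Proof. by []. Qed.

Lemma symmxN X : symmx_val (- X) = - symmx_val X.
Proof. exact: (raddfN \val). Qed.

Lemma symmx0 : symmx_val (0 : symmx R d) = 0.
Proof. exact: (raddf0 \val). Qed.

Lemma symmx_sum (I : finType) (F : I -> symmx R d) :
  symmx_val (\sum_i F i) = \sum_i symmx_val (F i).
Proof. exact: (raddf_sum \val). Qed.

Lemma symmx_inj : injective (@symmx_val R d).
Proof. exact: val_inj. Qed.

Lemma sym_is_linear : linear sym.
Proof.
move=> t M N; apply: symmx_inj; rewrite symmxD symmxZ /=.
by rewrite linearD linearZ /= scalerDr addrACA.
Qed.

HB.instance Definition _ :=
  GRing.isLinear.Build R 'M[R]_d (symmx R d) _ sym sym_is_linear.

Lemma symK X : sym (2^-1 *: (X : 'M[R]_d)) = X.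
Proof.
apply: symmx_inj; rewrite /= linearZ /= symmxT -scalerDl -[RHS]scale1r.
by congr (_ *: _); field.
Qed.

(** [symouter v a] is the derivative of [sqr] at [v] in the direction [a] (see [sqrD]). The factor
    [2^-1] in [sqr] undoes the doubling by [sym]. *)
Definition symouter a b : symmx R d := sym (a *m b^T).
Definition sqr v : symmx R d := sym (2^-1 *: (v *m v^T)).

Lemma symouterE a b : symmx_val (symouter a b) = a *m b^T + b *m a^T.
Proof. by rewrite /= trmx_mul trmxK. Qed.

Lemma sqrE v : symmx_val (sqr v) = v *m v^T.
Proof.
have -> : sqr v = 2^-1 *: symouter v v by rewrite /sqr linearZ.
rewrite symmxZ symouterE scalerDr -scalerDl -[RHS]scale1r.
by congr (_ *: _); field.
Qed.

Lemma bformC X u w : bform X u w = bform X w u.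
Proof. by rewrite /bform -[u^T *m _ *m w]trmxK mxE !trmx_mul trmxK symmxT mulmxA. Qed.

Lemma bformD X Y u w : bform (X + Y) u w = bform X u w + bform Y u w.
Proof. by rewrite symmxD bformDm. Qed.

Lemma bformZ t X u w : bform (t *: X) u w = t * bform X u w.
Proof. by rewrite symmxZ bformZm. Qed.

Lemma bformN X u w : bform (- X) u w = - bform X u w.
Proof. by rewrite -scaleN1r bformZ mulN1r. Qed.

Lemma bform_sum (I : finType) (F : I -> symmx R d) u w :
  bform (\sum_i F i) u w = \sum_i bform (F i) u w.
Proof. by rewrite symmx_sum bform_summ. Qed.

Lemma bform_sqr v u w : bform (sqr v) u w = dot v u * dot v w.
Proof. by rewrite sqrE bform_outer. Qed.

Lemma psdD X Y : psd X -> psd Y -> psd (X + Y).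
Proof. by move=> pX pY v; rewrite -/(bform _ _ _) bformD addr_ge0 ?pX ?pY. Qed.

Lemma psdZ t X : 0 <= t -> psd X -> psd (t *: X).
Proof. by move=> t0 pX v; rewrite -/(bform _ _ _) bformZ mulr_ge0 ?pX. Qed.

Lemma psd0 : psd (0 : symmx R d).
Proof. by move=> v; rewrite -/(bform _ _ _) symmx0 bform0. Qed.

Lemma psd_sqr v : psd (sqr v).
Proof. by move=> u; rewrite -/(bform _ _ _) bform_sqr -expr2 sqr_ge0. Qed.

Lemma psd_sum (I : finType) (F : I -> symmx R d) :
  (forall i, psd (F i)) -> psd (\sum_i F i).
Proof.
by move=> pF v; rewrite -/(bform _ _ _) bform_sum sumr_ge0 // => i _; apply: pF.
Qed.

Lemma psd_cauchy_schwarz X u w : psd X ->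
  bform X u w ^+ 2 <= bform X u u * bform X w w.
Proof.
move=> pX; have [q0|q_neq0] := eqVneq (bform X w w) 0.
  have [->|c0] := eqVneq (bform X u w) 0; first by rewrite expr0n mulr_ge0 ?pX.
  (* This value would make the form at [u + s *: w] equal to -1. *)
  pose s := - (bform X u u + 1) / (2 * bform X u w).
  have := pX (u + s *: w); rewrite -/(bform _ _ _) bformDl !bformDr !bformZl !bformZr.
  rewrite q0 (bformC X w u) !mulr0 addr0 -addrA -mulrDl.
  have -> : (s + s) * bform X u w = - (bform X u u + 1).
    by rewrite /s; field.
  lra.
have q_gt0 : 0 < bform X w w by rewrite lt_neqAle eq_sym q_neq0 pX.
have := pX (u - (bform X u w / bform X w w) *: w).
rewrite -/(bform _ _ _) -scaleNr bformDl !bformDr !bformZl !bformZr (bformC X w u).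
set c := bform X u w; set q := bform X w w; set a := bform X u u.
have -> : a + - (c / q) * c + (- (c / q) * c + - (c / q) * (- (c / q) * q)) =
  (a * q - c ^+ 2) / q by field.
by rewrite pmulr_lge0 ?invr_gt0 // subr_ge0.
Qed.

Lemma psd_ker X w : psd X -> bform X w w = 0 -> (X : 'M[R]_d) *m w = 0.
Proof.
move=> pX q0; apply: dot_eq0 => u; rewrite dotC -bform_dot; apply/eqP.
by rewrite -sqrf_eq0 eq_le sqr_ge0 andbT -[leRHS](mulr0 (bform X u u)) -q0
  psd_cauchy_schwarz.
Qed.

(** One step of symmetric Gaussian elimination: if the form of [X] is positive at [w], then
    [X - sqr (pivot X w)] is the Schur complement annihilating [w]. *)
Definition pivot (X : symmx R d) w : 'cV[R]_d :=
  (Num.sqrt (bform X w w))^-1 *: ((X : 'M[R]_d) *m w).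

Lemma dot_pivot X w u : dot (pivot X w) u = (Num.sqrt (bform X w w))^-1 * bform X u w.
Proof. by rewrite dotC dotZr -bform_dot. Qed.

Lemma psd_sub_pivot X w : psd X -> 0 < bform X w w -> psd (X - sqr (pivot X w)).
Proof.
move=> pX q0 u; rewrite -/(bform _ _ _) bformD bformN bform_sqr subr_ge0 !dot_pivot.
have -> : forall s t : R, s * t * (s * t) = s ^+ 2 * t ^+ 2 by move=> s t; ring.
rewrite exprVn sqr_sqrtr ?(ltW q0) // mulrC ler_pdivrMr //.
exact: psd_cauchy_schwarz.
Qed.

Lemma psd_neq0 X : psd X -> X != 0 -> exists w, 0 < bform X w w.
Proof.
move=> pX; apply: contra_neqP => noX; apply: symmx_inj.
rewrite symmx0; apply/matrixP => i j; rewrite [RHS]mxE.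
have Xj : (X : 'M[R]_d) *m delta_mx j 0 = 0 :> 'cV_d.
  apply: psd_ker => //; apply/eqP; rewrite eq_le pX andbT leNgt.
  by apply/negP => h; apply: noX; exists (delta_mx j 0).
by move/matrixP/(_ i 0): Xj; rewrite -colE !mxE.
Qed.

Lemma trace_sqr v : \tr (sqr v) = dot v v.
Proof. by rewrite sqrE mxtrace_mulC /mxtrace big_ord1. Qed.

Lemma trace_form X : \tr X = \sum_i bform X (delta_mx i 0) (delta_mx i 0).
Proof.
apply: eq_bigr => i _; rewrite /bform trmx_delta -rowE -colE.
by rewrite !mxE.
Qed.

Lemma trace_ge0 X : psd X -> 0 <= \tr X.
Proof. by move=> pX; rewrite trace_form sumr_ge0 // => i _; apply: pX. Qed.

Lemma trace_eq0 X : psd X -> \tr X = 0 -> X = 0.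
Proof.
move=> pX; rewrite trace_form => /eqP.
rewrite psumr_eq0; last by move=> i _; apply: pX.
move=> /allP t0; apply: symmx_inj; rewrite symmx0.
apply/matrixP => i j; rewrite [RHS]mxE.
have /matrixP/(_ i 0) : (X : 'M[R]_d) *m delta_mx j 0 = 0 :> 'cV_d.
  by apply: psd_ker => //; apply/eqP/t0/mem_index_enum.
by rewrite -colE !mxE.
Qed.

Lemma trace_psd_gt0 X : psd X -> X != 0 -> 0 < \tr X.
Proof.
move=> pX X0; rewrite lt_neqAle trace_ge0 // andbT eq_sym.
by apply: contra_neq X0; apply: trace_eq0.
Qed.

Lemma sqr_eq0 v : (sqr v == 0) = (v == 0).
Proof.
apply/eqP/eqP => [s0|->]; last by rewrite /sqr mul0mx scaler0 linear0.
apply/eqP; apply: contraT => /dot_gt0; rewrite -trace_sqr s0 symmx0 mxtrace0.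
by rewrite ltxx.
Qed.

Lemma sqrZ t v : sqr (t *: v) = t ^+ 2 *: sqr v.
Proof.
apply: symmx_inj; rewrite symmxZ !sqrE linearZ /= -scalemxAl -scalemxAr scalerA.
by rewrite expr2.
Qed.

Lemma sqrD u v : sqr (u + v) = sqr u + symouter u v + sqr v.
Proof.
apply: symmx_inj; rewrite !symmxD symouterE !sqrE linearD /= mulmxDl !mulmxDr.
by rewrite !addrA.
Qed.

Lemma symouterC u v : symouter u v = symouter v u.
Proof. by apply: symmx_inj; rewrite !symouterE addrC. Qed.

Lemma symouterZr t u v : symouter u (t *: v) = t *: symouter u v.
Proof. by rewrite /symouter linearZ /= -scalemxAr linearZ. Qed.

End Forms.

(** * Forms that are nonnegative on a subspace *)

Section Cone.
Variables (R : realType) (d : nat).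
Implicit Types (u v w a b : 'cV[R]_d) (X Y W P : symmx R d) (M : 'M[R]_d).

(** A form nonnegative in codimension [m] has at most [m] negative directions, and one square
    repairs each. In the induction a direction [w] of negative value joins the subspace, so the
    codimension drops with [m]. *)
Lemma psd_complete m W M :
  (d <= \rank M + m)%N ->
  (forall u, (u^T <= M)%MS -> 0 <= bform W u u) ->
  exists v : 'I_m -> 'cV[R]_d, psd (W + \sum_i sqr (v i)).
Proof.
elim: m W M => [|m IH] W M rM WM.
  exists (fun=> 0); rewrite big_ord0 addr0 => v; apply: WM.
  by rewrite submx_full // /row_full eqn_leq rank_leq_col -[leqRHS]addn0.
have [pW|] := pselect (psd W).
  by exists (fun=> 0); apply: psdD => //; apply: psd_sum => i; apply: psd_sqr.
move=> /existsNP[w /negP]; rewrite -ltNge -/(bform _ _ _) => qw.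
pose v0 : 'cV[R]_d := (Num.sqrt (- bform W w w))^-1 *: ((W : 'M[R]_d) *m w).
have v0E u : dot v0 u ^+ 2 = bform W u w ^+ 2 / - bform W w w.
  rewrite dotC dotZr -bform_dot exprMn exprVn sqr_sqrtr ?oppr_ge0 ?(ltW qw) //.
  by rewrite mulrC.
(* [W + sqr v0] dominates [W] and annihilates [w], so it is nonnegative on
   [M + w^T], whose rank is larger than that of [M]. *)
have W1E u : bform (W + sqr v0) u u = bform W u u + bform W u w ^+ 2 / - bform W w w.
  by rewrite bformD bform_sqr -expr2 v0E.
have [||v pv] := IH (W + sqr v0) (M + w^T)%MS.
- have ltM : (M < M + w^T)%MS.
    rewrite ltmxE addsmxSl /=; apply/negP => /(submx_trans (addsmxSr _ _))/WM.
    by rewrite leNgt qw.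
  rewrite addnS in rM; apply: (leq_trans rM).
  by rewrite -addSn leq_add2r rank_ltmx.
- move=> u /sub_addsmxP[[y z]] /= uE.
  have /WM yM : (((y *m M)^T)^T <= M)%MS by rewrite trmxK submxMl.
  set u1 := (y *m M)^T in yM.
  have -> : u = u1 + z 0 0 *: w.
    transitivity ((y *m M + z *m w^T)^T); first by rewrite -uE trmxK.
    rewrite linearD /= -/u1 trmx_mul trmxK; congr (_ + _).
    by apply/matrixP => i j; rewrite mxE big_ord1 !mxE (ord1 j) mulrC.
  set t := z 0 0; rewrite W1E bformDl !bformDr !bformZl !bformZr bformDl bformZl.
  rewrite (bformC W w u1).
  set c := bform W u1 w; set q := bform W w w in qw *; set f := bform W u1 u1 in yM *.
  have q0 : q != 0 by rewrite lt_eqF.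
  have -> : f + t * c + (t * c + t * (t * q)) + (c + t * q) ^+ 2 / - q =
    f + c ^+ 2 / - q by field.
  by rewrite addr_ge0 // divr_ge0 ?sqr_ge0 // oppr_ge0 ltW.
exists (fun i => if unlift ord0 i is Some j then v j else v0).
rewrite big_ord_recl unlift_none addrA.
by under eq_bigr do rewrite liftK.
Qed.

(* The tangent cone of [psd] at [\sum_i sqr (v i)]. *)
Definition psd_perp m (v : 'I_m -> 'cV[R]_d) : set (symmx R d) :=
  [set W | forall u, (forall i, dot (v i) u = 0) -> 0 <= bform W u u].

Lemma psd_perpD m (v : 'I_m -> 'cV[R]_d) X Y :
  psd_perp v X -> psd_perp v Y -> psd_perp v (X + Y).
Proof. by move=> pX pY u uv; rewrite bformD addr_ge0 ?pX ?pY. Qed.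

Lemma psd_perp_complete m (v : 'I_m -> 'cV[R]_d) W : psd_perp v W ->
  exists a : 'I_m -> 'cV[R]_d, psd (W + \sum_i sqr (a i)).
Proof.
move=> pW; pose V : 'M[R]_(d, m) := \matrix_(j, i) v i j 0.
apply: (@psd_complete m W (kermx V)).
  by rewrite mxrank_ker -leq_subLR subKn ?rank_leq_row ?rank_leq_col.
move=> u /sub_kermxP uV; apply: pW => i; rewrite dotC.
move/matrixP/(_ 0 i): uV; rewrite [RHS]mxE => <-.
by rewrite dotE mxE; apply: eq_bigr => j _; rewrite !mxE.
Qed.

(** By polarization [W] vanishes as a bilinear form on the orthogonal complement of the [v i]; only
    the cross terms with the [v i] survive. *)
Lemma psd_perp_lineality m (v : 'I_m -> 'cV[R]_d) W :
  psd_perp v W -> psd_perp v (- W) ->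
  exists a : 'I_m -> 'cV[R]_d, W = \sum_i symouter (v i) (a i).
Proof.
move=> pW nW.
have W0 u w : (forall i, dot (v i) u = 0) -> (forall i, dot (v i) w = 0) ->
    bform W u w = 0.
  have W00 u' : (forall i, dot (v i) u' = 0) -> bform W u' u' = 0.
    move=> u'v; apply/eqP; rewrite eq_le pW // andbT -oppr_ge0 -bformN.
    exact: nW.
  move=> uv wv; have := W00 (u + w).
  rewrite bformDl !bformDr (bformC W w u) !W00 // add0r addr0 => h.
  have : bform W u w + bform W u w = 0.
    by apply: h => i; rewrite dotDr uv wv addr0.
  by lra.
pose V : 'M[R]_(d, m) := \matrix_(j, i) v i j 0.
(* A generalized inverse, since the [v i] may be linearly dependent. *)
have [G VGV] : exists G, V^T *m G *m V^T = V^T.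
  by exists (pinvmx V^T); apply: mulmxKpV.
(* [Q] maps into the orthogonal complement of the [v i]; expanding
   [Q^T *m W *m Q = 0] expresses [W] as [V *m A^T + A *m V^T]. *)
pose Q := 1%:M - G *m V^T.
have VQ : V^T *m Q = 0 by rewrite mulmxBr mulmx1 mulmxA VGV subrr.
have dotQ i (u : 'cV[R]_d) : dot (v i) (Q *m u) = 0.
  have /matrixP/(_ i 0) : V^T *m (Q *m u) = 0 by rewrite mulmxA VQ mul0mx.
  rewrite [RHS]mxE => <-; rewrite dotE mxE.
  by apply: eq_bigr => j _; rewrite !mxE.
have QWQ : Q^T *m (W : 'M[R]_d) *m Q = 0.
  apply/matrixP => i j; rewrite [RHS]mxE.
  have := W0 _ _ (dotQ^~ (delta_mx i 0)) (dotQ^~ (delta_mx j 0)).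
  rewrite /bform trmx_mul trmx_delta -!mulmxA -rowE !mulmxA -colE => <-.
  by rewrite !mxE; apply: eq_bigr => l _; rewrite !mxE.
(* [W] equals [W G V^T + V G^T W - V G^T W G V^T]; the factor [2^-1] splits the last term evenly
   between [A *m V^T] and its transpose. *)
pose A := (W : 'M[R]_d) *m G - 2^-1 *: (V *m G^T *m (W : 'M[R]_d) *m G).
have WE : (W : 'M[R]_d) = V *m A^T + A *m V^T.
  have AT : A^T = G^T *m (W : 'M[R]_d) - 2^-1 *: (G^T *m (W : 'M[R]_d) *m G *m V^T).
    rewrite /A linearB linearZ /= !trmx_mul !trmxK symmxT.
    by rewrite !mulmxA.
  rewrite AT /A mulmxBr mulmxBl -scalemxAr -scalemxAl.
  move: QWQ; rewrite /Q [(_ - _)^T]linearB /= trmx1 trmx_mul trmxK mulmxBl mul1mx.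
  rewrite mulmxBr mulmx1 mulmxBl !mulmxA.
  set C := V *m G^T *m (W : 'M[R]_d) *m G *m V^T.
  set B := V *m G^T *m (W : 'M[R]_d).
  set B' := (W : 'M[R]_d) *m G *m V^T.
  move: C B B' => C B B' /eqP; rewrite subr_eq0 subr_eq => /eqP ->.
  set D := 2^-1 *: C; have -> : C = D + D.
    by rewrite -scalerDl -[LHS]scale1r; congr (_ *: _); field.
  by rewrite opprD [RHS]addrACA [LHS]addrAC [B + B']addrC.
exists (fun i => col i A); apply: symmx_inj; rewrite symmx_sum WE.
apply/matrixP => j l; rewrite !mxE summxE -big_split /=.
apply: eq_bigr => i _; rewrite !mxE !big_ord1 !mxE.
by rewrite [X in _ = _ + X]mulrC.
Qed.

End Cone.

(** * Extreme rays of the psd cone and of its linear images *)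

Section Rays.
Variables (R : realType) (d : nat).
Implicit Types (u v w a b : 'cV[R]_d) (X Y W P : symmx R d) (M : 'M[R]_d).

Lemma bform_inj X Y : (forall u w, bform X u w = bform Y u w) -> X = Y.
Proof.
move=> XY; apply: symmx_inj; apply/matrixP => i j.
have := XY (delta_mx i 0) (delta_mx j 0).
by rewrite /bform trmx_delta -!rowE -!colE !mxE.
Qed.

(** [Y] kills the orthogonal complement of [v], so its values depend only on the components of the
    arguments along [v]. *)
Lemma psd_rank1 v Y : v != 0 -> psd Y ->
  (forall u, dot v u = 0 -> bform Y u u = 0) ->
  exists2 t, 0 <= t & Y = t *: sqr v.
Proof.
move=> v0 pY Y0; have vv := dot_gt0 v0.
have Yu u w : dot v u = 0 -> bform Y u w = 0.
  by move=> /Y0/(psd_ker pY) Yu0; rewrite bformC bform_dot Yu0 dot0r.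
have YE u w : bform Y u w = dot v u / dot v v * bform Y v w.
  rewrite -bformZl; apply/eqP; rewrite -subr_eq0 -mulN1r -bformZl -bformDl.
  apply/eqP/Yu; rewrite dotDr !dotZr mulN1r divfK ?subrr //.
  by rewrite gt_eqF.
exists (bform Y v v / dot v v ^+ 2); first by rewrite divr_ge0 ?pY ?sqr_ge0.
apply: bform_inj => u w; rewrite bformZ bform_sqr YE bformC YE.
by field; rewrite gt_eqF.
Qed.

Lemma ray_id (V : lmodType R) (x : V) : ray x x.
Proof. by exists 1; rewrite /= ?ler01 ?scale1r. Qed.

Lemma rayZ (V : lmodType R) t (x : V) : 0 < t -> ray (t *: x) = ray x.
Proof.
move=> t0; apply/seteqP; split=> _ [s /= s0 <-].
  by exists (s * t); rewrite /= ?mulr_ge0 ?(ltW t0) ?scalerA.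
exists (s / t); first by rewrite /= divr_ge0 // ltW.
by rewrite scalerA divfK // gt_eqF.
Qed.

Lemma ray_eq (V : lmodType R) (x y : V) : y != 0 -> ray x y -> ray y = ray x.
Proof.
move=> y0 [t /= t0 txy]; rewrite -txy rayZ // lt_neqAle t0 andbT eq_sym.
by apply: contra_neq y0 => t0'; rewrite -txy t0' scale0r.
Qed.

Lemma image_ray (U V : lmodType R) (f : {linear U -> V}) x :
  f @` ray x = ray (f x).
Proof.
apply/seteqP; split=> [_ [_ [t /= t0 <-] <-]|_ [t /= t0 <-]].
  by exists t; rewrite ?linearZ.
by exists (t *: x); [exists t|rewrite linearZ].
Qed.

Lemma extreme_ray_sqr v : v != 0 -> extreme_ray (@psd R d) (ray (sqr v)).
Proof.
move=> v0; split.
- by exists (sqr v); rewrite ?sqr_eq0.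
- by move=> _ [t /= t0 <-]; apply: psdZ => //; apply: psd_sqr.
have aux y z : psd y -> psd z -> ray (sqr v) (y + z) -> ray (sqr v) y.
  move=> py pz [t /= t0 yz].
  have [|s s0 ->] := psd_rank1 v0 py; last by exists s.
  move=> u uv; apply/eqP; rewrite eq_le py andbT.
  have := pz u; rewrite -/(bform _ _ _) => pzu.
  suff : bform (y + z) u u = 0 by rewrite bformD; lra.
  by rewrite -yz bformZ bform_sqr uv mul0r mulr0.
by move=> y z py pz yz; split; [apply: aux yz|apply: aux; rewrite 1?addrC].
Qed.

Lemma dot_pivot_self X w : 0 < bform X w w -> 0 < dot (pivot X w) w.
Proof. by move=> q0; rewrite dot_pivot mulr_gt0 // invr_gt0 sqrtr_gt0. Qed.

Lemma pivot_neq0 X w : 0 < bform X w w -> pivot X w != 0.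
Proof.
move=> /dot_pivot_self q0; apply: contraTneq q0 => ->.
by rewrite dotC dot0r ltxx.
Qed.

Section Image.
Variables (V : lmodType R) (B : {linear symmx R d -> V}).
Hypothesis B_psd0 : forall X, psd X -> B X = 0 -> X = 0.
Let C := B @` @psd R d.

Lemma image_sqr_neq0 v : v != 0 -> B (sqr v) != 0.
Proof.
move=> v0; apply/eqP => /(B_psd0 (psd_sqr v)) /eqP.
by rewrite sqr_eq0 (negPf v0).
Qed.

(** [X] is [sqr (pivot X w)] plus a psd remainder, so the face property puts the image of the square
    on the ray. *)
Lemma extreme_ray_pivot X w x : extreme_ray C (ray x) -> B X = x -> psd X ->
  0 < bform X w w -> ray (B (sqr (pivot X w))) = ray x.
Proof.
move=> [_ _ ex] BX pX q0; apply: ray_eq.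
  exact/image_sqr_neq0/pivot_neq0.
apply: (proj1 (ex _ (B (X - sqr (pivot X w))) _ _ _)).
- by exists (sqr (pivot X w)) => //; apply: psd_sqr.
- by exists (X - sqr (pivot X w)) => //; apply: psd_sub_pivot.
by rewrite -linearD addrC subrK BX; apply: ray_id.
Qed.

Lemma extreme_ray_image r : extreme_ray C r ->
  exists2 v, v != 0 & r = ray (B (sqr v)).
Proof.
move=> er; have [[x x0 rx] rC _] := er; rewrite rx in er rC *.
have [X pX BX] := rC _ (ray_id x).
have [|w q0] := psd_neq0 pX.
  by apply: contraNneq x0 => X0; rewrite -BX X0 linear0.
exists (pivot X w); first exact: pivot_neq0.
by rewrite (extreme_ray_pivot er BX).
Qed.

Lemma generates_extreme_ray_image x : generates_extreme_ray C x ->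
  exists2 v, v != 0 & x = B (sqr v).
Proof.
move=> [x0 /extreme_ray_image[v v0 xE]].
have [t /= t0 tx] : ray (B (sqr v)) x by rewrite -xE; apply: ray_id.
exists (Num.sqrt t *: v); last by rewrite sqrZ linearZ /= sqr_sqrtr.
rewrite scaler_eq0 (negPf v0) orbF sqrtr_eq0 -ltNge lt_neqAle t0 andbT eq_sym.
by apply: contra_neq x0 => t00; rewrite -tx t00 scale0r.
Qed.

Hypothesis B_trace : forall X Y, B X = B Y -> \tr X = \tr Y.
Hypothesis B_bij :
  set_bij (extreme_ray (@psd R d)) (extreme_ray C) (fun r => B @` r).

Lemma set_bij_generates v : v != 0 -> generates_extreme_ray C (B (sqr v)).
Proof.
move=> v0; split; first exact: image_sqr_neq0.
have [Bf _ _] := B_bij; rewrite -(image_ray B); apply: Bf.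
exact: extreme_ray_sqr.
Qed.

(** If [P] were positive at some [u] orthogonal to [v], its pivot at [u] would give another extreme
    ray with the image of [ray (sqr v)], against injectivity. So [P] is a multiple of [sqr v], and
    the trace fixes the factor. *)
Lemma set_bij_rank1_unique v P : v != 0 -> psd P -> B P = B (sqr v) ->
  P = sqr v.
Proof.
move=> v0 pP BP; have [Bf Binj _] := B_bij.
have [_ er] := set_bij_generates v0.
have [|t t0 PE] := psd_rank1 v0 pP.
  move=> u uv; apply/eqP; rewrite eq_le pP andbT leNgt; apply/negP => q0.
  have := extreme_ray_pivot er BP pP q0; rewrite -!(image_ray B) => /Binj pv.
  have : ray (sqr v) (sqr (pivot P u)).
    rewrite -pv; first exact: ray_id.
    - by rewrite inE; apply/extreme_ray_sqr/pivot_neq0.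
    - by rewrite inE; apply/extreme_ray_sqr.
  move=> [s /= _ /(congr1 (fun X => bform X u u))].
  rewrite bformZ !bform_sqr uv mul0r mulr0 => /esym/eqP.
  by rewrite mulf_eq0 orbb gt_eqF // dot_pivot_self.
have := B_trace BP; rewrite PE symmxZ mxtraceZ => tE.
suff -> : t = 1 by rewrite scale1r.
apply: (@mulIf _ (\tr (sqr v))); last by rewrite mul1r.
by rewrite trace_sqr gt_eqF ?dot_gt0.
Qed.

(** Some square added to [W] gives a psd matrix with the same image as that square, hence equal to
    it by [set_bij_rank1_unique]. *)
Lemma set_bij_psd_perp0 v W : psd_perp (fun _ : 'I_1 => v) W -> B W = 0 -> W = 0.
Proof.
move=> /psd_perp_complete[a]; rewrite big_ord1; set b := a ord0 => pW BW.
have [b0|b0] := eqVneq b 0.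
  move: pW; rewrite b0.
  have -> : sqr (0 : 'cV[R]_d) = 0 by apply/eqP; rewrite sqr_eq0.
  by rewrite addr0 => /B_psd0; apply.
have := set_bij_rank1_unique b0 pW; rewrite linearD /= BW add0r => /(_ erefl).
by move=> /eqP; rewrite -subr_eq0 addrK => /eqP.
Qed.

End Image.
End Rays.

(** * Closedness of linear images of closed cones *)

Section LinearImage.
Variables (R : realType) (p : nat).

Lemma linear_rV_continuous (V : normedModType R) (f : {linear 'rV[R]_p -> V}) :
  continuous f.
Proof.
have -> : (f : 'rV_p -> V) = fun x => \sum_i x 0 i *: f (delta_mx 0 i).
  apply/funext => x; rewrite {1}(row_sum_delta x) linear_sum.
  by apply: eq_bigr => i _; rewrite linearZ.
apply: continuous_big => [|i _ x]; first exact: add_continuous.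
apply: cvgZr_tmp; first exact: (nbhs_filter x).
exact: (@coord_continuous R 1 p 0 i x).
Qed.

Lemma closed_norm_preimage (A : set R) :
  closed A -> closed [set x : 'rV[R]_p | A `|x|].
Proof.
move=> cA; apply: (@preimage_closed _ _ (fun x : 'rV[R]_p => `|x|) A) => //.
by move=> x _; apply: norm_continuous.
Qed.

Variables (N : nat) (f : {linear 'rV[R]_p -> 'cV[R]_N}) (K : set 'rV[R]_p).
Hypotheses (K_closed : closed K)
  (K_cone : forall t x, 0 < t -> K x -> K (t *: x))
  (f_inj : forall x, K x -> f x = 0 -> x = 0).

(** By homogeneity it suffices to treat the unit vectors of [K], a compact set on which the norm of
    [f] has a positive minimum. *)
Lemma cone_image_norm_ge : exists2 c : R, 0 < c & forall x, K x -> c * `|x| <= `|f x|.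
Proof.
pose S := K `&` [set x | `|x| = 1].
have normS x : K x -> x != 0 -> S (`|x|^-1 *: x).
  move=> Kx x0; have nx : 0 < `|x| by rewrite normr_gt0.
  split; first by apply: K_cone; rewrite ?invr_gt0.
  by rewrite /= normrZ gtr0_norm ?invr_gt0 // mulVf // gt_eqF.
have [S0|/set0P S0] := eqVneq S set0.
  exists 1 => // x Kx; have [->|x0] := eqVneq x 0; first by rewrite normr0 mulr0.
  by have := normS x Kx x0; rewrite S0.
have cS : compact S.
  apply: bounded_closed_compact.
    by exists 1; split => // M M1 x [_ /= ->]; apply: ltW.
  apply: closedI => //; exact: closed_norm_preimage (@closed_eq R _).
have [|x0 Sx0 min] := EVT_min_rV S0 cS (f := fun x => `|f x|).
  apply: continuous_subspaceT => x.
  apply: continuous_comp; first exact: linear_rV_continuous.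
  exact: norm_continuous.
have [Kx0 nx0] : S x0 by rewrite -in_setE.
exists (`|f x0|).
  rewrite normr_gt0; apply: contra_eq_neq nx0 => /f_inj -> //.
  by rewrite normr0 eq_sym oner_eq0.
move=> x Kx; have [->|x1] := eqVneq x 0; first by rewrite normr0 mulr0.
have nx : 0 < `|x| by rewrite normr_gt0.
have := min (`|x|^-1 *: x); rewrite in_setE => /(_ (normS x Kx x1)).
rewrite linearZ /= normrZ gtr0_norm ?invr_gt0 // mulrC ler_pdivlMr //.
Qed.

(** The lower bound confines the preimages of points within distance 1 of [y] to a compact part of
    [K], whose image is closed. *)
Lemma closed_cone_image : closed (f @` K).
Proof.
have [c c0 cK] := cone_image_norm_ge.
move=> y yK; pose KM := K `&` [set x | `|x| <= (`|y| + 1) / c].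
have cKM : compact KM.
  apply: bounded_closed_compact.
    exists ((`|y| + 1) / c); split; first exact: num_real.
    by move=> M MM x [_ /= xM]; apply/(le_trans xM)/ltW.
  apply: closedI => //; exact: closed_norm_preimage (@closed_le R _).
have clKM : closed (f @` KM).
  apply: compact_closed; first exact: norm_hausdorff.
  apply: continuous_compact => //.
  by apply: continuous_subspaceT; apply: linear_rV_continuous.
suff /clKM[x [Kx _] <-] : closure (f @` KM) y by exists x.
move=> U Uy; have [|_ [[x Kx <-] [Ux yx]]] := yK (U `&` ball y 1).
  by apply: filterI => //; apply: nbhsx_ballx.
exists (f x); split=> //; exists x => //; split=> //=.
rewrite ler_pdivlMr // mulrC (le_trans (cK x Kx)) //.
rewrite -ball_normE /= in yx.
rewrite -[f x](subrK y) addrC (le_trans (ler_normD _ _)) //.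
by rewrite lerD2l distrC ltW.
Qed.

End LinearImage.

(** * Closed images of cones of symmetric matrices *)

Section Closedness.
Variables (R : realType).

Lemma closed_halfspace p (phi : 'rV[R]_p -> R) :
  (forall t x y, phi (t *: x + y) = t * phi x + phi y) ->
  closed [set x | 0 <= phi x].
Proof.
move=> philin.
pose phi' : {linear 'rV[R]_p -> R^o} :=
  HB.pack phi (GRing.isLinear.Build _ _ _ _ (phi : _ -> R^o) philin).
apply: (@preimage_closed _ _ phi [set r : R | 0 <= r]); last exact: closed_ge.
move=> x _. have := @linear_rV_continuous R p R^o phi' x. exact.
Qed.

Variables (d N : nat) (B : {linear symmx R d -> 'cV[R]_N}) (U : set 'cV[R]_d).

(** The set [U] is left general to cover both the psd cone and [psd_perp v]. *)
Lemma closed_image_psd_on :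
  let D := [set W : symmx R d | forall u, U u -> 0 <= bform W u u] in
  (forall W, D W -> B W = 0 -> W = 0) -> closed (B @` D).
Proof.
move=> D D0.
(* [symmx] carries only algebraic structure, so the cone is moved to row vectors; [2^-1] makes [f]
   agree with [B] on symmetric matrices. *)
pose f : {linear 'rV[R]_(d * d) -> 'cV[R]_N} :=
  B \o @sym R d \o *:%R 2^-1 \o vec_mx.
(* Symmetry is expressed by inequalities over all [i] and [j], which makes [K] an intersection of
   closed half-spaces. *)
pose skew i j (x : 'rV[R]_(d * d)) : R := vec_mx x j i - vec_mx x i j.
pose K := [set x : 'rV[R]_(d * d) | (forall i j, 0 <= skew i j x) /\
   forall u, U u -> 0 <= bform (vec_mx x) u u].
have K_mxvec (W : symmx R d) : D W -> K (mxvec W).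
  move=> DW; split=> [i j|u Uu]; last by rewrite mxvecK DW.
  by rewrite /skew mxvecK -{1}symmxT mxE subrr.
have f_mxvec (W : symmx R d) : f (mxvec W) = B W.
  by rewrite /= mxvecK symK.
have KE x : K x -> exists2 W, D W & x = mxvec (symmx_val W).
  move=> [sx Ux]; have xT : vec_mx x = (vec_mx x)^T.
    apply/matrixP => i j; rewrite [RHS]mxE; apply/eqP; rewrite eq_le.
    by rewrite -subr_ge0 (sx i j) -subr_ge0 (sx j i).
  have WE : symmx_val (sym (2^-1 *: vec_mx x)) = vec_mx x.
    rewrite /= linearZ /= -xT -scalerDl -[RHS]scale1r.
    by congr (_ *: _); field.
  exists (sym (2^-1 *: vec_mx x)); last by rewrite WE vec_mxK.
  by move=> u Uu; rewrite WE Ux.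
have -> : B @` D = f @` K.
  apply/seteqP; split=> [_ [W DW <-]|_ [x /KE[W DW ->] <-]].
    by exists (mxvec W); [exact: K_mxvec|exact: f_mxvec].
  by exists W => //; rewrite f_mxvec.
apply: closed_cone_image => [|t x t0 [sx Ux]|x /KE[W DW ->]].
- have -> : K = (\bigcap_(i in setT) \bigcap_(j in setT) [set x | 0 <= skew i j x])
       `&` \bigcap_(u in U) [set x | 0 <= bform (vec_mx x) u u].
    apply/seteqP; split=> x [sx Ux]; split=> // i; first by move=> _ j _; apply: sx.
    by move=> j; apply: (sx i I j I).
  apply: closedI.
    apply: closed_bigI => i _; apply: closed_bigI => j _.
    apply: closed_halfspace => t x y; rewrite /skew linearP /= !mxE.
    by ring.
  apply: closed_bigI => u _; apply: closed_halfspace => t x y.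
  by rewrite linearP /= bformDm bformZm.
- split=> [i j|u Uu]; last by rewrite linearZ /= bformZm mulr_ge0 ?(ltW t0) ?Ux.
  have -> : skew i j (t *: x) = t * skew i j x.
    by rewrite /skew linearZ /= mulrBr; congr (_ - _); rewrite mxE.
  by rewrite mulr_ge0 ?(ltW t0) // sx.
- by rewrite f_mxvec => /(D0 W DW) ->; rewrite symmx0 linear0.
Qed.

End Closedness.

(** * Tangent spaces of the image cone *)

Section Tangent.
Variables (R : realType) (d N : nat) (B : {linear symmx R d -> 'cV[R]_N}).
Let C := B @` @psd R d.

Lemma closed_image_psd : (forall X, psd X -> B X = 0 -> X = 0) -> closed C.
Proof.
move=> B0.
have -> : C = B @` [set W : symmx R d | forall u, setT u -> 0 <= bform W u u].
  apply/seteqP; split=> _ [W pW <-]; exists W => // u; first by move=> _; apply: pW.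
  exact: pW.
apply: closed_image_psd_on => W pW; apply: B0 => u; exact: pW.
Qed.

Variables (m : nat) (v : 'I_m -> 'cV[R]_d).
Let X := \sum_i sqr (v i).

(** The form of [X] vanishes on the complement of the [v i], so [Z - X] is nonnegative there for psd
    [Z]. The closure adds nothing, since the kernel condition makes the image of [psd_perp v]
    closed. *)
Lemma tangent_cone_image : (forall W, psd_perp v W -> B W = 0 -> W = 0) ->
  tangent_cone C (B X) `<=` B @` psd_perp v.
Proof.
move=> B0 y yT; have cl : closed (B @` psd_perp v).
  exact: (@closed_image_psd_on R d N B [set u | forall i, dot (v i) u = 0]).
apply: cl; apply: closureS yT => _ [l [c [z [cz ->]]]].
have zB i : exists2 W, psd_perp v W & c i *: z i = B W.
  have [ci [_ [Z pZ <-] <-]] := cz i.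
  exists (c i *: (Z - X)); last by rewrite [RHS]linearZ /= [in RHS]linearB.
  move=> u uv; rewrite bformZ mulr_ge0 // bformD bformN bform_sum.
  rewrite big1 ?subr0 => [|j _]; first exact: pZ.
  by rewrite bform_sqr uv mul0r.
elim/big_ind: _ => [|_ _ [W1 p1 <-] [W2 p2 <-]|i _].
- by exists 0; [move=> u _; rewrite symmx0 bform0|rewrite linear0].
- by exists (W1 + W2); [exact: psd_perpD|rewrite linearD].
- by have [W pW ->] := zB i; exists W.
Qed.

(** The curve [\sum_i sqr (v i + t *: a i)] stays psd and has the required derivative at [t = 0]. *)
Lemma tangent_cone_symouter (a : 'I_m -> 'cV[R]_d) :
  tangent_cone C (B X) (B (\sum_i symouter (v i) (a i))).
Proof.
set y := B (\sum_i symouter _ _); pose w := B (\sum_i sqr (a i)).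
move=> U /nbhs_ballP[e /= e0 eU].
have w0 : 0 < `|w| + 1 by rewrite ltr_wpDl.
(* The difference quotient is exactly [y + t *: w], and this [t] puts it within [e] of [y]. *)
pose t := e / (`|w| + 1) / 2.
have t0 : 0 < t by rewrite !divr_gt0.
exists (y + t *: w); split; last first.
  apply: eU; rewrite -ball_normE.
  rewrite /= -/y.
  have -> : y - (y + t *: w) = - (t *: w) by rewrite opprD addrA subrr add0r.
  rewrite normrN normrZ gtr0_norm //.
  have -> : t * `|w| = e * (`|w| / ((`|w| + 1) * 2)).
    by rewrite /t; field; rewrite gt_eqF.
  rewrite gtr_pMr // ltr_pdivrMr ?mulr_gt0 // mul1r.
  have := normr_ge0 w; lra.
exists 1%N, (fun=> t^-1), (fun=> B (\sum_i sqr (v i + t *: a i)) - B X).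
split=> [_|].
  split; first by rewrite invr_ge0 ltW.
  exists (B (\sum_i sqr (v i + t *: a i))) => //.
  by exists (\sum_i sqr (v i + t *: a i)) => //; apply: psd_sum => i; apply: psd_sqr.
rewrite big_ord1 -linearB.
have -> : \sum_i sqr (v i + t *: a i) - X =
    t *: (\sum_i symouter (v i) (a i)) + t ^+ 2 *: (\sum_i sqr (a i)).
  rewrite /X -sumrB !scaler_sumr -big_split /=; apply: eq_bigr => i _.
  by rewrite sqrD symouterZr sqrZ -!addrA addrC -addrA subrK.
rewrite linearD !linearZ /= scalerDr !scalerA mulVf ?gt_eqF // scale1r.
by rewrite expr2 mulrA mulVf ?gt_eqF // mul1r.
Qed.

(** Elements of [psd_perp v] with opposite images add up to a kernel element, hence to 0, so they
    lie in the lineality space. *)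
Lemma tangent_space_image : (forall W, psd_perp v W -> B W = 0 -> W = 0) ->
  tangent_space C (B X) =
  [set B (\sum_i symouter (v i) (a i)) | a in [set: 'I_m -> 'cV[R]_d]].
Proof.
move=> B0; apply/seteqP; split=> [y [] | _ [a _ <-]].
  move=> /(tangent_cone_image B0)[W1 p1 <-].
  move=> [z /(tangent_cone_image B0)[W2 p2 <-] W12].
  have W120 : W1 + W2 = 0.
    by apply: B0; [exact: psd_perpD|rewrite linearD -W12 addNr].
  have W2E : W2 = - W1 by apply/eqP; rewrite -addr_eq0 addrC W120.
  have [|a W1E] := psd_perp_lineality p1; first by rewrite -W2E.
  by exists a => //; rewrite W1E.
split; first exact: tangent_cone_symouter.
exists (B (\sum_i symouter (v i) (- a i))).
  exact: (@tangent_cone_symouter (fun i => - a i)).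
rewrite -linearN -sumrN; congr (B _); apply: eq_bigr => i _.
by rewrite -[- a i]scaleN1r symouterZr scaleN1r opprK.
Qed.

End Tangent.

Lemma rank_sum_sqr (R : realType) d m (v : 'I_m -> 'cV[R]_d) :
  (\rank (symmx_val (\sum_i sqr (v i))%R) <= m)%N.
Proof.
pose V : 'M[R]_(d, m) := \matrix_(j, i) v i j 0.
have -> : symmx_val (\sum_i sqr (v i)) = V *m V^T.
  apply/matrixP => j l; rewrite symmx_sum summxE mxE; apply: eq_bigr => i _.
  by rewrite sqrE !mxE big_ord1 !mxE.
exact: leq_trans (mxrankM_maxl _ _) (rank_leq_col _).
Qed.

Lemma tangent_space_image_sqr (R : realType) d N
  (B : {linear symmx R d -> 'cV[R]_N}) v :
  (forall W, psd_perp (fun _ : 'I_1 => v) W -> B W = 0 -> W = 0) ->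
  tangent_space (B @` @psd R d) (B (sqr v)) =
  [set B (symouter v a) | a in [set: 'cV[R]_d]].
Proof.
move=> /tangent_space_image; rewrite big_ord1 => ->.
apply/seteqP; split=> _ [a _ <-].
  by exists (a ord0) => //; rewrite big_ord1.
by exists (fun=> a) => //; rewrite big_ord1.
Qed.

(** * Equality and kernel of the augmented map *)

Section TraceAugment.
Variables (R : realType) (d n : nat) (A : {linear symmx R d -> 'cV[R]_n}).
Implicit Types X Y W : symmx R d.

Lemma trace_augmentP X Y :
  trace_augment A X = trace_augment A Y <-> A X = A Y /\ \tr X = \tr Y.
Proof.
split=> [/eq_col_mx[-> /matrixP/(_ 0 0)]|[AXY trXY]].
  by rewrite !mxE eqxx !mulr1n.
by rewrite /trace_augment AXY trXY.
Qed.

Lemma trace_augment_trace X Y :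
  trace_augment A X = trace_augment A Y -> \tr X = \tr Y.
Proof. by case/trace_augmentP. Qed.

Lemma trace_augment_eq0 X :
  trace_augment A X = 0 <-> A X = 0 /\ \tr X = 0.
Proof.
rewrite -[0 in X in X <-> _](linear0 (trace_augment A)) trace_augmentP.
by rewrite linear0 symmx0 mxtrace0.
Qed.

Lemma trace_augment_psd0 X : psd X -> trace_augment A X = 0 -> X = 0.
Proof. by move=> pX /trace_augment_eq0[_]; apply: trace_eq0. Qed.

End TraceAugment.

(** * From exact recovery to Terracini convexity *)

Section Recovery.
Variables (R : realType) (d n k : nat) (A : {linear symmx R d -> 'cV[R]_n}).
Hypotheses (k_gt0 : (0 < k)%N) (A_exact : exact_recovery A k).
Implicit Types X Y W : symmx R d.

Let B : {linear symmx R d -> 'cV[R]_(n + 1)} := trace_augment A.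
Let C := B @` @psd R d.

(** [Y] is feasible with the optimal trace, so it is optimal too. *)
Lemma exact_recovery_unique X Y : psd X -> (\rank X <= k)%N -> psd Y ->
  B Y = B X -> Y = X.
Proof.
move=> pX rX pY /trace_augmentP[AYX trYX].
have SDPX := A_exact pX rX.
have [_ Xmin] : SDP A (A X) X by rewrite SDPX.
have : SDP A (A X) Y.
  by split=> // Z /Xmin; rewrite trYX.
by rewrite SDPX.
Qed.

(** Completing [W] by [m] squares gives a psd matrix with the same image as the sum of these
    squares, which has rank at most [k]. *)
Lemma exact_recovery_psd_perp0 m (v : 'I_m -> 'cV[R]_d) W : (m <= k)%N ->
  psd_perp v W -> B W = 0 -> W = 0.
Proof.
move=> mk /psd_perp_complete[a pW] BW.
suff /eqP : W + \sum_i sqr (a i) = \sum_i sqr (a i).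
  by rewrite -subr_eq0 addrK => /eqP.
apply: exact_recovery_unique => //.
- by apply: psd_sum => i; apply: psd_sqr.
- exact: leq_trans (rank_sum_sqr _) mk.
- by rewrite linearD /= BW add0r.
Qed.

Lemma exact_recovery_sqr_unique t v Y : psd Y ->
  B Y = t *: B (sqr v) -> 0 <= t -> Y = t *: sqr v.
Proof.
move=> pY BY t0; rewrite -(sqr_sqrtr t0) -sqrZ.
apply: exact_recovery_unique => //; first exact: psd_sqr.
  have := rank_sum_sqr (fun _ : 'I_1 => Num.sqrt t *: v).
  by rewrite big_ord1 => /leq_trans; apply.
by rewrite sqrZ linearZ /= sqr_sqrtr.
Qed.

Lemma exact_recovery_set_bij :
  set_bij (extreme_ray (@psd R d)) (extreme_ray C) (fun r => B @` r).
Proof.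
have B0 := @trace_augment_psd0 _ _ _ A.
have psdE r : extreme_ray (@psd R d) r -> exists2 v, v != 0 & r = ray (sqr v).
  (* With the identity map, [extreme_ray_image] classifies the extreme rays of the psd cone
     itself. *)
  have imid : (@idfun (symmx R d)) @` @psd R d = @psd R d by rewrite image_id.
  rewrite -{1}imid => er.
  have [|v v0 ->] := extreme_ray_image _ er; first by [].
  by exists v.
split.
- move=> _ /psdE[v v0 ->]; rewrite (image_ray B); split.
  + by exists (B (sqr v)) => //; apply: image_sqr_neq0.
  + move=> _ [t /= t0 <-]; exists (t *: sqr v); last by rewrite linearZ.
    exact/psdZ/psd_sqr.
  + move=> _ _ [Y pY <-] [Z pZ <-] [t /= t0 /esym]; rewrite -linearD => YZ.
    (* The sum is recovered upstairs as [t *: sqr v], so extremality is inherited from the psd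
       cone. *)
    have YZE := exact_recovery_sqr_unique (psdD pY pZ) YZ t0.
    have [_ _ ex] := extreme_ray_sqr v0.
    have [|[s s0 <-] [s' s'0 <-]] := ex Y Z pY pZ; first by exists t.
    by rewrite !linearZ; split; [exists s|exists s'].
- move=> _ _ /[!inE] /psdE[v v0 ->] /psdE[w w0 ->].
  rewrite !(image_ray B) => vw.
  have [t /= t0 tw] : ray (B (sqr w)) (B (sqr v)) by rewrite -vw; apply: ray_id.
  apply: ray_eq; rewrite ?sqr_eq0 //; exists t => //.
  by rewrite -(exact_recovery_sqr_unique (psd_sqr v) (esym tw) t0).
- move=> r /extreme_ray_image[|v v0 ->]; first exact: B0.
  by exists (ray (sqr v)); [exact: extreme_ray_sqr|rewrite (image_ray B)].
Qed.

Lemma exact_recovery_terracini : terracini_convexity_property (trace_augment A) k.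
Proof.
have B0 := @trace_augment_psd0 _ _ _ A.
split.
- exact: (closed_image_psd (B := B)).
- apply/seteqP; split=> [_ [[X pX <-] [_ [Y pY <-] YX]]|_ ->].
    have XY0 : X + Y = 0.
      by apply: B0; [exact: psdD|rewrite linearD /= -YX addNr].
    suff -> : X = 0 by rewrite linear0.
    apply: trace_eq0 => //; apply/eqP; rewrite eq_le trace_ge0 // andbT.
    by rewrite -(mxtrace0 R d) -symmx0 -XY0 symmxD mxtraceD lerDl trace_ge0.
  by split; [|exists 0; rewrite ?oppr0 //];
    (exists 0; [exact: psd0|rewrite linear0]).
- exact: exact_recovery_set_bij.
move=> x xC.
have /choice[v vE] : forall i, exists v, x i = B (sqr v).
  by move=> i; have [v _ ->] := generates_extreme_ray_image B0 (xC i); exists v.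
have -> : \sum_i x i = B (\sum_i sqr (v i)).
  by rewrite linear_sum; apply: eq_bigr => i _; rewrite vE.
rewrite (@tangent_space_image _ _ _ B) => [|W]; last exact: exact_recovery_psd_perp0.
have tE i : tangent_space C (x i) = [set B (symouter (v i) a) | a in [set: 'cV[R]_d]].
  by rewrite vE tangent_space_image_sqr // => W; apply: exact_recovery_psd_perp0.
apply/seteqP; split=> [_ [a _ <-]|_ [u [uT ->]]].
  exists (fun i => B (symouter (v i) (a i))); rewrite linear_sum; split=> // i.
  by rewrite -/C tE; exists (a i).
have /choice[a aE] : forall i, exists a, u i = B (symouter (v i) a).
  by move=> i; have := uT i; rewrite -/C tE => -[a _ <-]; exists a.
by exists a => //; rewrite linear_sum; apply: eq_bigr => i _; rewrite aE.
Qed.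

End Recovery.

(** * Dimension of the sums of [symouter (v i) (a i)] for fixed [v] *)

Lemma card_leading_pairs d k : (k <= d)%N ->
  #|[pred t : 'I_d * 'I_d | (t.1 < k)%N && (t.1 <= t.2)%N]| =
  ('C(d.+1, 2) - 'C((d - k).+1, 2))%N.
Proof.
move=> kd; rewrite -sum1_card.
rewrite -(pair_big_dep (fun i : 'I_d => (i < k)%N)
                       (fun i j : 'I_d => (i <= j)%N) (fun _ _ => 1%N)) /=.
have row i : (\sum_(j < d | (i <= j)%N) 1 = d - i)%N.
  by rewrite -(big_geq_mkord i d xpredT (fun=> 1%N)) sum_nat_const_nat muln1.
under eq_bigr do rewrite row.
rewrite -(big_ord_widen_cond _ xpredT (fun i => (d - i)%N) kd) /=.
(* The new first index [k] adds [d - k] pairs, which is also the drop of the subtracted binomial. *)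
elim: k kd => [|k IH] kd; first by rewrite big_ord0 subn0 subnn.
rewrite big_ord_recr /= IH ?(ltnW kd) //.
have kE : (d - k = (d - k.+1).+1)%N by rewrite -subSn // subSS.
have binE : 'C((d - k).+1, 2) = ('C((d - k.+1).+1, 2) + (d - k))%N.
  by rewrite kE (binS _ 1) bin1.
have : ('C((d - k).+1, 2) <= 'C(d.+1, 2))%N by rewrite leq_bin2l // ltnS leq_subr.
rewrite binE => le_bin; rewrite subnDA subnK // leq_subRL //.
exact: leq_trans (leq_addr _ _) le_bin.
Qed.

Section Dimension.
Variables (R : realType) (d n k : nat).

Lemma mxrank_sum_le (I : finType) (T : {pred I}) (g : I -> 'rV[R]_n) :
  (\rank (\sum_(t in T) <<g t>>)%MS <= #|T|)%N.
Proof.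
rewrite -sum1_card; apply: (big_ind2 (fun (S : 'M[R]_n) s => \rank S <= s)%N).
- by rewrite mxrank0.
- move=> S1 s1 S2 s2 h1 h2; apply: leq_trans (leq_add h1 h2).
  exact: (mxrank_adds_leqif S1 S2).1.
- by move=> t _; rewrite genmxE rank_leq_row.
Qed.

(** In a basis [u] whose first [k] members span the [v i], the matrices [symouter (u j) (u l)] with
    [j < k] and [j <= l] span all these sums. *)
Lemma symouter_sum_dim (f : {linear symmx R d -> 'cV[R]_n})
    (v : 'I_k -> 'cV[R]_d) : (k <= d)%N ->
  (forall y, exists a : 'I_k -> 'cV[R]_d, y = f (\sum_i symouter (v i) (a i))) ->
  (n <= 'C(d.+1, 2) - 'C((d - k).+1, 2))%N.
Proof.
move=> kd fv; rewrite -card_leading_pairs //.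
set T := [pred t : _ * _ | _].
pose V : 'M[R]_(k, d) := \matrix_(i, j) v i j 0.
(* Since [V = L *m U] with [U] invertible, the rows of [U] are a basis, and only the first
   [\rank V <= k] of them enter the [v i]. *)
pose U := row_ebase V; pose L : 'M[R]_(k, d) := col_ebase V *m pid_mx (\rank V).
pose u j := (row j U)^T.
pose g (t : 'I_d * 'I_d) := (f (symouter (u t.1) (u t.2)))^T.
have vE i : v i = \sum_j L i j *: u j.
  have /matrixP VE : V = L *m U by rewrite mulmx_ebase.
  apply/matrixP => l z; rewrite (ord1 z); have := VE i l; rewrite !mxE => ->.
  by rewrite summxE; apply: eq_bigr => j _; rewrite !mxE.
have L0 i (j : 'I_d) : (k <= j)%N -> L i j = 0.
  move=> kj; rewrite mxE big1 // => l _; rewrite mxE.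
  case: eqP => [lj|]; last by rewrite mulr0.
  by have := ltn_ord l; rewrite lj ltnNge kj.
have aE (a : 'cV[R]_d) : exists b : 'I_d -> R, a = \sum_j b j *: u j.
  exists (fun j => (a^T *m invmx U) 0 j).
  have /matrixP aU : a^T = a^T *m invmx U *m U by rewrite mulmxKV // row_ebase_unit.
  apply/matrixP => l z; rewrite (ord1 z); have := aU 0 l; rewrite [LHS]mxE => ->.
  by rewrite mxE summxE; apply: eq_bigr => j _; rewrite !mxE.
have symouter_suml (I : finType) (w : I -> 'cV[R]_d) b :
    symouter (\sum_j w j) b = \sum_j symouter (w j) b.
  by rewrite /symouter mulmx_suml linear_sum.
have symouter_sumr (I : finType) (w : I -> 'cV[R]_d) b :
    symouter b (\sum_j w j) = \sum_j symouter b (w j).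
  by rewrite symouterC symouter_suml; apply: eq_bigr => j _; rewrite symouterC.
have gT (j l : 'I_d) : (j < k)%N -> (g (j, l) <= \sum_(t in T) <<g t>>)%MS.
  move=> jk; have [jl|lj] := leqP j l.
    by apply: (submx_trans _ (sumsmx_sup (j, l) _ (submx_refl _)));
      rewrite ?genmxE // inE jk.
  (* Here [l < j < k], so the swapped pair lies in [T]. *)
  have -> : g (j, l) = g (l, j) by rewrite /g symouterC.
  apply: (submx_trans _ (sumsmx_sup (l, j) _ (submx_refl _))); rewrite ?genmxE //.
  by rewrite inE /= (ltn_trans lj jk) ltnW.
have yT (y : 'cV[R]_n) : (y^T <= \sum_(t in T) <<g t>>)%MS.
  have [a ->] := fv y; rewrite linear_sum linear_sum; apply: summx_sub => i _.
  rewrite vE symouter_suml linear_sum linear_sum; apply: summx_sub => j _.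
  have [kj|jk] := leqP k j.
    by rewrite L0 // scale0r /symouter mul0mx !linear0 sub0mx.
  have [b ->] := aE (a i).
  rewrite symouter_sumr linear_sum linear_sum; apply: summx_sub => l _.
  rewrite symouterZr symouterC symouterZr symouterC !linearZ /=.
  by do 2 apply: scalemx_sub; apply: gT.
apply: leq_trans (mxrank_sum_le T g); rewrite -[leqLHS](mxrank1 R n).
by apply: mxrankS; apply/row_subP => i; rewrite -[row i _]trmxK yT.
Qed.

End Dimension.

(** * Positive definite matrices are interior to the psd cone *)

Section Interior.
Variables (R : realType) (d : nat).
Implicit Types (x : 'cV[R]_d) (W Y : symmx R d).

Lemma posdef_psd W : posdef W -> psd W.
Proof.
move=> pW x; have [->|/pW/ltW//] := eqVneq x 0.
by rewrite mulmx0 mxE.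
Qed.

(** A coordinate of [x] is its [W]-product with a column of [invmx W], so Cauchy-Schwarz for [W]
    bounds it. *)
Lemma posdef_coord_bound W : posdef W ->
  exists g : 'I_d -> R, (forall i, 0 <= g i) /\
    forall x i, x i 0 ^+ 2 <= g i * bform W x x.
Proof.
move=> pW; have Wu : symmx_val W \in unitmx.
  rewrite unitmxE unitfE; apply/negP => /det0P[v v0 vW].
  have : 0 < bform W v^T v^T by apply: pW; rewrite trmx_eq0.
  by rewrite /bform trmxK vW mul0mx mxE ltxx.
pose u i : 'cV[R]_d := invmx (symmx_val W) *m delta_mx i 0.
exists (fun i => bform W (u i) (u i)); split=> [i|x i].
  exact: posdef_psd.
suff <- : bform W (u i) x = x i 0.
  by apply: psd_cauchy_schwarz; apply: posdef_psd.
rewrite bformC bform_dot mulmxA mulmxV // mul1mx dotE (bigD1 i) //= big1 ?addr0.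
  by rewrite mxE !eqxx mulr1.
by move=> j ji; rewrite mxE (negPf ji) mulr0.
Qed.

(** The coordinate bounds dominate the form of [Y] by [M] times that of [W]; [M + 1] is inverted
    because [M] may be 0. *)
Lemma posdef_absorbing W Y : posdef W -> exists2 t, 0 < t & psd (W + t *: Y).
Proof.
move=> pW; have [g [g0 gW]] := posdef_coord_bound pW.
pose M := \sum_i \sum_j `|symmx_val Y i j| * (g i + g j).
have M0 : 0 <= M.
  by do 2 apply: sumr_ge0 => ? _; rewrite mulr_ge0 // addr_ge0.
have YM x : `|bform Y x x| <= M * bform W x x.
  rewrite bform_dot dotE mulr_suml (le_trans (ler_norm_sum _ _ _)) //.
  apply: ler_sum => i _; rewrite mxE mulr_sumr mulr_suml.
  rewrite (le_trans (ler_norm_sum _ _ _)) //; apply: ler_sum => j _.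
  rewrite mulrCA normrM -mulrA ler_wpM2l // mulrDl.
  apply: le_trans (lerD (gW x i) (gW x j)).
  rewrite ler_norml; have := sqr_ge0 (x i 0 + x j 0); have := sqr_ge0 (x i 0 - x j 0).
  have := sqr_ge0 (x i 0); have := sqr_ge0 (x j 0); rewrite !expr2 => *.
  by apply/andP; split; lra.
exists (M + 1)^-1; first by rewrite invr_gt0 ltr_wpDl.
move=> x; rewrite -/(bform _ _ _) bformD bformZ mulrC.
have M1 : 0 < M + 1 by rewrite ltr_wpDl.
rewrite -(pmulr_lge0 _ M1) mulrDl divfK ?gt_eqF //.
have := YM x; rewrite ler_norml => /andP[h _].
have : 0 <= bform W x x by exact: posdef_psd.
by move: h; rewrite mulrDr mulr1 (mulrC (bform W x x)); lra.
Qed.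

End Interior.

(** * From Terracini convexity on an open set to exact recovery *)

Section Converse.
Variables (R : realType) (d n : nat).
Implicit Types (A : {linear symmx R d -> 'cV[R]_n}) (X Y W : symmx R d).

Lemma mx_norm_coord m p (M : 'M[R]_(m, p)) i j : `|M i j| <= `|M|.
Proof.
rewrite [leRHS]/Num.norm /= mx_normrE.
by apply/bigmax_geP; right; exists (i, j).
Qed.

(** The form of [- X] vanishes on the kernel of [X], of codimension at most [k], so [k] squares make
    it psd. *)
Lemma psd_sub_complete k X Y : (0 < d)%N ->
  psd X -> (\rank X <= k)%N -> psd Y ->
  exists2 v : 'I_k -> 'cV[R]_d, (forall i, v i != 0) &
    psd (Y - X + \sum_i sqr (v i)).
Proof.
move=> d0 pX rX pY.
have [|u uX|v pv] := @psd_complete R d k (- X) (kermx (symmx_val X)).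
- by rewrite mxrank_ker -leq_subLR subKn ?rank_leq_row.
- move: uX => /sub_kermxP uX.
  by rewrite bformN /bform uX mul0mx mxE oppr0.
(* Zero vectors are replaced by a nonzero [e], as only nonzero ones give extreme rays; this merely
   adds squares. *)
pose e : 'cV[R]_d := const_mx 1.
have e0 : e != 0.
  apply/eqP => /matrixP/(_ (Ordinal d0) 0); rewrite !mxE => /eqP.
  by rewrite oner_eq0.
exists (fun i => if v i == 0 then e else v i); first by move=> i; case: ifP => // ->.
rewrite -addrA; apply: psdD => //.
have -> : - X + \sum_i sqr (if v i == 0 then e else v i) =
    - X + \sum_i sqr (v i) + \sum_i (if v i == 0 then sqr e else 0).
  rewrite -addrA -big_split; congr (_ + _); apply: eq_bigr => i _ /=.
  have [->|_] := eqVneq (v i) 0; last by rewrite addr0.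
  by rewrite (_ : sqr 0 = 0) ?add0r //; apply/eqP; rewrite sqr_eq0.
apply: psdD => //; apply: psd_sum => i.
by case: ifP => _; [exact: psd_sqr|exact: psd0].
Qed.

(** The map [A' Y = A Y + s l(Y) A X] with [l(W) = 1] sends [W] to [s A X] and [X] to
    [(1 + s l(X)) A X], whence [t = s / (1 + s l(X))]. *)
Lemma perturb_kernel A (S : set {linear symmx R d -> 'cV[R]_n}) W X :
  open_linear_maps S -> S A -> A W = 0 -> W != 0 ->
  exists A' : {linear symmx R d -> 'cV[R]_n}, S A' /\
    exists2 t, 0 < t & A' (W - t *: X) = 0.
Proof.
move=> oS SA AW W0; have [e e0 eS] := oS A SA.
have [i [j Wij]] : exists i j, symmx_val W i j != 0.
  apply: contrapT => noW; move/eqP: W0; apply; apply: symmx_inj; rewrite symmx0.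
  apply/matrixP => i j; rewrite [RHS]mxE; apply/eqP; apply: contrapT => /negP h.
  by apply: noW; exists i, j.
pose l Y := symmx_val Y i j / symmx_val W i j.
have l_linear t Y Z : l (t *: Y + Z) = t * l Y + l Z.
  by rewrite /l symmxD symmxZ !mxE mulrDl mulrA.
have lW : l W = 1 by rewrite /l divff.
(* A common bound for the perturbation per unit of [s] and for the absolute value of [l X]; the
   added 1 keeps it positive. *)
pose c := (`|A X| + `|symmx_val X i j| + 1) / `|symmx_val W i j|.
have nW : 0 < `|symmx_val W i j| by rewrite normr_gt0.
have c0 : 0 < c by rewrite divr_gt0 // ltr_wpDl // addr_ge0.
(* [e] keeps [A'] in [S]; [2^-1] keeps [1 + s * l X] positive. *)
pose q := Num.min e 2^-1.
have q0 : 0 < q by rewrite lt_min e0 invr_gt0 ltr0n.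
pose s := q / c.
have s0 : 0 < s by rewrite divr_gt0.
have sc : s * c = q by rewrite divfK // gt_eqF.
have A'_linear : linear (fun Y => A Y + (s * l Y) *: A X).
  move=> t Y Z; rewrite linearP l_linear mulrDr scalerDl scalerDr scalerA.
  by rewrite addrACA mulrCA.
pose A' : {linear symmx R d -> 'cV[R]_n} :=
  HB.pack (fun Y => A Y + (s * l Y) *: A X)
    (GRing.isLinear.Build _ _ _ _ (fun Y => A Y + (s * l Y) *: A X) A'_linear).
have A'E Y : A' Y = A Y + (s * l Y) *: A X by [].
exists A'; split.
  apply: eS => Y; rewrite A'E addrC addKr normrZ normrM (gtr0_norm s0).
  have lY : `|l Y| <= `|symmx_val Y| / `|symmx_val W i j|.
    by rewrite /l normrM normfV ler_pM2r ?invr_gt0 // mx_norm_coord.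
  have AXc : `|A X| / `|symmx_val W i j| <= c.
    by rewrite ler_pM2r ?invr_gt0 // -addrA lerDl addr_ge0.
  apply: (@le_trans _ _ (s * (`|symmx_val Y| / `|symmx_val W i j|) * `|A X|)).
    by rewrite ler_wpM2r // ler_wpM2l // ltW.
  have -> : s * (`|symmx_val Y| / `|symmx_val W i j|) * `|A X| =
    s * (`|A X| / `|symmx_val W i j|) * `|symmx_val Y| by ring.
  rewrite ler_wpM2r // (@le_trans _ _ (s * c)) //; first by rewrite ler_wpM2l // ltW.
  by rewrite sc ge_min lexx.
have lX : `|s * l X| <= 2^-1.
  rewrite normrM (gtr0_norm s0) (@le_trans _ _ (s * c)) //.
    rewrite ler_wpM2l ?(ltW s0) // /l normrM normfV ler_pM2r ?invr_gt0 //.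
    by rewrite addrAC lerDr addr_ge0.
  by rewrite sc ge_min lexx orbT.
have lX1 : 0 < 1 + s * l X by move: lX; rewrite ler_norml => /andP[]; lra.
exists (s / (1 + s * l X)); first by rewrite divr_gt0.
set t := s / _.
rewrite A'E linearB linearZ /= AW sub0r -scaleNr -scalerDl.
have -> : l (W - t *: X) = 1 - t * l X.
  by rewrite addrC -scaleNr l_linear lW mulNr addrC.
have -> : - t + s * (1 - t * l X) = 0 by rewrite /t; field; rewrite gt_eqF.
by rewrite scale0r.
Qed.

(* A trace-decreasing kernel direction puts the image of [\sum_i sqr (v i)] in
   the interior of the cone, so that its tangent space is everything, whereas
   Terracini convexity makes it the span of the [A (symouter (v i) a)]. *)
Lemma terracini_dim A k (v : 'I_k -> 'cV[R]_d) W t : (k <= d)%N ->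
  surjective_with_posdef_kernel A ->
  terracini_convexity_property (trace_augment A) k ->
  (forall i, v i != 0) -> A W = 0 -> \tr W < 0 -> 0 < t ->
  psd (W + t *: \sum_i sqr (v i)) ->
  (n <= 'C(d.+1, 2) - 'C((d - k).+1, 2))%N.
Proof.
move=> kd [Asurj [W0 [/= AW0 pW0]]] [_ _ bij terr] v0 AW trW t0.
set X := \sum_i sqr (v i) => pWX.
pose B : {linear symmx R d -> 'cV[R]_(n + 1)} := trace_augment A.
have B0 := @trace_augment_psd0 R d n A.
have Btr := @trace_augment_trace R d n A.
have trW0 : 0 < \tr W0.
  apply: trace_psd_gt0; first exact: posdef_psd.
  (* [W0 = 0] is positive definite only when no nonzero vector exists, and then [W = 0]. *)
  apply: contraTneq trW => WW0; rewrite -leNgt.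
  suff -> : W = 0 by rewrite symmx0 mxtrace0.
  apply: bform_inj => u w; have [->|u0] := eqVneq u 0.
    by rewrite symmx0 -(scale0r (0 : 'cV[R]_d)) !bformZl !mul0r.
  by have := pW0 u u0; rewrite -/(bform _ _ _) WW0 symmx0 bform0 ltxx.
(* Cancels the trace, so that [W + c *: W0] lies in the kernel of [B]. *)
pose c := - \tr W / \tr W0.
have c0 : 0 < c by rewrite divr_gt0 // oppr_gt0.
have BW : B (W + c *: W0) = 0.
  apply/trace_augment_eq0.
  split; first by rewrite linearD linearZ /= AW AW0 scaler0 addr0.
  rewrite symmxD symmxZ mxtraceD mxtraceZ /c divfK ?gt_eqF //.
  by rewrite subrr.
have xE : \sum_i B (sqr (v i)) = B X by rewrite linear_sum.
have BT Y : tangent_cone (B @` @psd R d) (B X) (B Y).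
  have [s s0 ps] := posdef_absorbing Y pW0.
  (* The psd matrix built below has image [B X + (c s / t) B Y], so [B Y] is a positive multiple of
     a difference from [B X] within the cone. *)
  apply: subset_closure.
  exists 1%N, (fun=> t / (c * s)),
    (fun=> B (t^-1 *: (W + t *: X + c *: (W0 + s *: Y))) - B X).
  split=> [_|].
    split; first by apply: ltW; rewrite divr_gt0 // mulr_gt0.
    exists (B (t^-1 *: (W + t *: X + c *: (W0 + s *: Y)))) => //.
    eexists; last reflexivity.
    apply: psdZ; first by rewrite invr_ge0 ltW.
    by apply: psdD => //; apply: psdZ => //; apply: ltW.
  rewrite big_ord1.
  have -> : W + t *: X + c *: (W0 + s *: Y) = W + c *: W0 + t *: X + (c * s) *: Y.
    by rewrite scalerDr scalerA addrA (addrAC W).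
  have BE : B (W + c *: W0 + t *: X + (c * s) *: Y) = t *: B X + (c * s) *: B Y.
    by rewrite linearD [B (_ + t *: X)]linearD BW add0r !linearZ.
  rewrite [B (t^-1 *: _)]linearZ /= -/B BE [t^-1 *: _]scalerDr !scalerA mulVf ?gt_eqF //.
  rewrite scale1r addrAC subrr add0r scalerA -[LHS]scale1r; congr (_ *: _).
  by field; rewrite !gt_eqF.
apply: (@symouter_sum_dim R d n k A v kd) => y.
have [Y _ <-] := Asurj y I.
have gen i : generates_extreme_ray (B @` @psd R d) (B (sqr (v i))).
  exact: (@set_bij_generates R d _ B).
have : tangent_space (B @` @psd R d) (\sum_i B (sqr (v i))) (B Y).
  rewrite xE; split; first exact: BT.
  by exists (B (- Y)); [exact: BT|rewrite linearN opprK].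
rewrite (terr _ gen) => -[u [uT BYE]].
have /choice[a aE] : forall i, exists a, u i = B (symouter (v i) a).
  move=> i; have := uT i; rewrite (@tangent_space_image_sqr _ _ _ B).
    by move=> [a _ <-]; exists a.
  by move=> Z; apply: (@set_bij_psd_perp0 R d _ B).
exists a; have : B Y = B (\sum_i symouter (v i) (a i)).
  by rewrite BYE linear_sum; apply: eq_bigr => i _; rewrite aE.
by case/trace_augmentP.
Qed.

End Converse.

Theorem theorem4p5 (R : realType) (d n k : nat)
    (A : {linear symmx R d -> 'cV[R]_n}) (k_gt0 : (0 < k)%N)
    (k_lt_d : (k < d)%N) :
  (surjective_with_posdef_kernel A ->
   exact_recovery A k ->
   terracini_convexity_property (trace_augment A) k)
  /\
  (('C(d.+1, 2) - 'C((d - k).+1, 2) < n)%N ->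
   (exists S : set {linear symmx R d -> 'cV[R]_n},
     [/\ open_linear_maps S,
         S A,
         forall A' : {linear symmx R d -> 'cV[R]_n}, S A' ->
           surjective_with_posdef_kernel A'
       & forall A' : {linear symmx R d -> 'cV[R]_n}, S A' ->
           terracini_convexity_property (trace_augment A') k]) ->
   exact_recovery A k).
Proof.
split=> [_ Aex|n_gt [S [oS SA Ssurj Sterr]] X pX rX].
  exact: exact_recovery_terracini.
(* By contraposition: a second feasible [Y] of no larger trace forces [n] to be at most the binomial
   difference. *)
have unique Y : A Y = A X -> psd Y -> \tr Y <= \tr X -> Y = X.
  move=> AYX pY trYX; apply/eqP; rewrite -subr_eq0; apply: contraTT n_gt => YX.
  rewrite -leqNgt.
  have [v v0 pv] := psd_sub_complete (leq_ltn_trans (leq0n k) k_lt_d) pX rX pY.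
  have AYX0 : A (Y - X) = 0 by rewrite linearB AYX subrr.
  (* The trace of [Y - X] may be 0; subtracting nonzero squares makes it negative, at the price of a
     nearby map [A']. *)
  have [A' [SA' [t t0 A'0]]] :=
    perturb_kernel (\sum_i sqr (v i)) oS SA AYX0 YX.
  (* The factor [1 + t] restores the subtracted squares and leaves [Y - X] plus the squares, which
     is psd by [pv]. *)
  apply: (terracini_dim (ltnW k_lt_d) (Ssurj _ SA') (Sterr _ SA') v0 A'0
    (t := 1 + t)).
  - rewrite symmxD symmxN symmxZ mxtraceD raddfN /= mxtraceZ.
    have : \tr (symmx_val (Y - X)) <= 0.
      by rewrite symmxD symmxN mxtraceD raddfN /= subr_le0.
    suff : 0 < t * \tr (symmx_val (\sum_i sqr (v i))) by lra.
    rewrite mulr_gt0 // symmx_sum raddf_sum /= (bigD1 (Ordinal k_gt0)) //=.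
    rewrite ltr_pwDl ?trace_sqr ?dot_gt0 // sumr_ge0 // => i _.
    by rewrite trace_sqr dot_ge0.
  - by rewrite addr_gt0.
  - by rewrite scalerDl scale1r [Z in psd (_ + Z)]addrC addrA subrK.
apply/seteqP; split=> [Z [[AZ pZ] Zmin]|_ ->].
  exact/unique/Zmin.
split=> // Y [AY pY]; rewrite leNgt; apply/negP => ltYX.
by move: (ltYX); rewrite (unique Y) ?ltxx // ltW.
Qed.
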